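(* Let $p\ne q$ be primes, $A=\mathbb Z_p$, $F=\mathbb Z_q$, $\alpha\in\mathrm{Aut}(F)$, $\beta\in\mathrm{Aut}(A)$, and denote by $|\alpha|,|\beta|$ the orders of $\alpha,\beta$. Then $$\mathrm{Inv}(\alpha,\beta)=\mathrm{Ker}\,S(\alpha,\beta)+B(F,A).$$ Moreover, $$\dim\mathrm{Inv}(\alpha,\beta)=\begin{cases}q-1,&\text{if }|\beta|\text{ does not divide }|\alpha|,\\(q-1)+(q-1)(q-2)/|\alpha|,&\text{otherwise.}\end{cases}$$ Thus $$\dim\bigl(\mathrm{Inv}(\alpha,\beta)/B(F,A)\bigr)=\begin{cases}0,&\text{if }|\beta|\text{ does not divide }|\alpha|,\\(q-1)(q-2)/|\alpha|,&\text{otherwise.}\end{cases}$$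
   Context: Here $\mathbb Z_p,\mathbb Z_q$ are the additive cyclic groups, and dimensions are over $\mathrm{GF}(p)$. $C(F,A)$ is the $\mathrm{GF}(p)$-vector space (under pointwise operations) of all maps $\theta:F\times F\to A$ with $\theta(0,x)=\theta(x,0)=0$ for all $x\in F$, where $0$ is the neutral element of $F$. For $\tau:F\to A$ with $\tau(0)=0$ put $\widehat\tau(x,y)=\tau(x+y)-\tau(x)-\tau(y)$; $B(F,A)=\{\widehat\tau:\ \tau:F\to A,\ \tau(0)=0\}$ is a subspace of $C(F,A)$. For $(\alpha,\beta)\in\mathrm{Aut}(F)\times\mathrm{Aut}(A)$ let ${}^{(\alpha,\beta)}\theta(x,y)=\beta\theta(\alpha^{-1}x,\alpha^{-1}y)$. $S(\alpha,\beta):C(F,A)\to C(F,A)$ is the linear operator $S(\alpha,\beta)\theta=\theta-{}^{(\alpha,\beta)}\theta$, and $\mathrm{Inv}(\alpha,\beta)=\{\theta\in C(F,A):\ \theta-{}^{(\alpha,\beta)}\theta\in B(F,A)\}$. *)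

(* Defs.v *)
From HB Require Import structures.
From mathcomp Require Import all_boot all_order all_algebra all_fingroup.
From mathcomp Require Import generic_quotient ring_quotient.

Set Implicit Arguments.
Unset Strict Implicit.
Unset Printing Implicit Defensive.

Import GRing.Theory VectorInternalTheory.
Local Open Scope ring_scope.
Local Open Scope quotient_scope.

(* The quotient vector space vT / W, on the type of cosets Quotient.quot W (which the
   library only equips with an additive group structure). *)
Section QuotientSpace.
Variables (K : fieldType) (vT : vectType K) (W : {vspace vT}).

Definition quotv : Type := Quotient.quot W.
HB.instance Definition _ := GRing.Zmodule.on quotv.

Definition quotv_pi_fun (v : vT) : quotv := \pi_(Quotient.quot W) v.
Definition quotv_repr (u : quotv) : vT := repr (u : Quotient.quot W).

Lemma quotv_reprK u : quotv_pi_fun (quotv_repr u) = u.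
Proof. exact: reprK. Qed.

Lemma quotv_pi_eq u v : (quotv_pi_fun u == quotv_pi_fun v) = (u - v \in W).
Proof. by rewrite Quotient.idealrBE. Qed.

Lemma quotv_piD u v :
  quotv_pi_fun (u + v) = quotv_pi_fun u + quotv_pi_fun v.
Proof. exact: raddfD. Qed.

Definition quotv_scale (a : K) (u : quotv) : quotv :=
  quotv_pi_fun (a *: quotv_repr u).

Lemma quotv_piZ a v :
  quotv_pi_fun (a *: v) = quotv_scale a (quotv_pi_fun v).
Proof.
apply/eqP; rewrite quotv_pi_eq -scalerBr memvZ //.
by rewrite -quotv_pi_eq quotv_reprK.
Qed.

Fact quotv_scaleA a b u :
  quotv_scale a (quotv_scale b u) = quotv_scale (a * b) u.
Proof. by rewrite -[u]quotv_reprK -!quotv_piZ scalerA. Qed.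

Fact quotv_scale1 : left_id 1 quotv_scale.
Proof. by move=> u; rewrite -[u]quotv_reprK -!quotv_piZ scale1r. Qed.

Fact quotv_scaleDr : right_distributive quotv_scale +%R.
Proof.
move=> a u v; rewrite -[u]quotv_reprK -[v]quotv_reprK.
by rewrite -quotv_piD -!quotv_piZ scalerDr quotv_piD.
Qed.

Fact quotv_scaleDl u : {morph quotv_scale^~ u : a b / a + b}.
Proof.
by move=> a b; rewrite -[u]quotv_reprK -!quotv_piZ scalerDl quotv_piD.
Qed.

HB.instance Definition _ := GRing.Zmodule_isLmodule.Build K quotv
  quotv_scaleA quotv_scale1 quotv_scaleDr quotv_scaleDl.

Fact quotv_pi_is_linear : linear quotv_pi_fun.
Proof. by move=> a u v; rewrite quotv_piD quotv_piZ. Qed.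
HB.instance Definition _ :=
  GRing.isLinear.Build K vT quotv *:%R quotv_pi_fun quotv_pi_is_linear.

Fact quotv_vect_iso : Vector.axiom (dim (subvs_of (W^C)%VS)) quotv.
Proof.
pose g (u : quotv) := vsproj (W^C)%VS (daddv_pi (W^C)%VS W (quotv_repr u)).
have dCW : ((W^C) :&: W = 0)%VS by rewrite capvC capv_compl.
have dWC : (W :&: W^C = 0)%VS by rewrite capv_compl.
have g_pi v : g (quotv_pi_fun v) = vsproj (W^C)%VS (daddv_pi (W^C)%VS W v).
  rewrite /g; congr vsproj; apply/eqP; rewrite -subr_eq0 -linearB /=.
  set w := _ - _; have wW : w \in W by rewrite -quotv_pi_eq quotv_reprK.
  have := daddv_pi_add dCW (w := w); rewrite addvC addv_complf memvf.
  by move=> /(_ isT); rewrite (daddv_pi_id dWC wW) => /(canRL (addrK _));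
     rewrite subrr => ->.
exists (v2r \o g).
  move=> a u v /=; rewrite -[u]quotv_reprK -[v]quotv_reprK.
  by rewrite -linearP !g_pi !linearP.
exists (fun r => quotv_pi_fun (vsval (r2v r : subvs_of (W^C)%VS))) => [u|r] /=.
  rewrite v2rK /g vsprojK ?memv_pi //.
  rewrite -[RHS]quotv_reprK; apply/eqP; rewrite quotv_pi_eq.
  have := daddv_pi_add dCW (w := quotv_repr u).
  rewrite addvC addv_complf memvf => /(_ isT) => {2}<-.
  by rewrite opprD addNKr memvN memv_pi.
by rewrite g_pi (daddv_pi_id dCW) ?subvsP // vsvalK r2vK.
Qed.

HB.instance Definition _ := Lmodule_hasFinDim.Build K quotv quotv_vect_iso.

Definition quotv_pi : 'Hom(vT, quotv) := linfun quotv_pi_fun.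

Lemma lker_quotv_pi : lker quotv_pi = W.
Proof.
apply/vspaceP=> v; rewrite memv_ker lfunE /=.
by rewrite -(linear0 quotv_pi_fun) quotv_pi_eq subr0.
Qed.

Lemma limg_quotv_pi : limg quotv_pi = fullv.
Proof.
apply/vspaceP=> u; rewrite memvf; apply/memv_imgP.
by exists (quotv_repr u); rewrite ?memvf // lfunE /= quotv_reprK.
Qed.

End QuotientSpace.

Section AdditiveAut.
Variables (G : finZmodType) (s : {perm G}).
Context (s_aut : s \in Aut [set: G]).

Lemma Aut_D x y : s (x + y) = s x + s y.
Proof. by have /morphicP := Aut_morphic s_aut; apply; rewrite inE. Qed.

Lemma Aut_0 : s 0 = 0.
Proof. by apply: (addIr (s 0)); rewrite -Aut_D !add0r. Qed.

Lemma Aut_B x y : s (x - y) = s x - s y.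
Proof. by apply: (addIr (s y)); rewrite -Aut_D !subrK. Qed.

End AdditiveAut.

Section Cochains.
Variables (F : finZmodType) (p : nat).

Implicit Types (alpha : {perm F}) (beta : {perm 'F_p}).

(* ('F_p)^o is 'F_p seen as a vector space over itself. *)
Definition map1 := {ffun F -> ('F_p)^o}.
Definition map2 := {ffun F * F -> ('F_p)^o}.
HB.instance Definition _ := Vector.on map1.
HB.instance Definition _ := Vector.on map2.

Definition eval1 (x : F) (tau : map1) : ('F_p)^o := tau x.
Definition eval2 (z : F * F) (theta : map2) : ('F_p)^o := theta z.
Fact eval1_is_linear x : linear (eval1 x).
Proof. by move=> a u v; rewrite /eval1 !ffunE. Qed.
Fact eval2_is_linear z : linear (eval2 z).
Proof. by move=> a u v; rewrite /eval2 !ffunE. Qed.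
HB.instance Definition _ x :=
  GRing.isLinear.Build 'F_p map1 ('F_p)^o *:%R (eval1 x) (eval1_is_linear x).
HB.instance Definition _ z :=
  GRing.isLinear.Build 'F_p map2 ('F_p)^o *:%R (eval2 z) (eval2_is_linear z).

(* C(F, A), with A the additive group of 'F_p. *)
Definition Csp : {vspace map2} :=
  (\bigcap_(x : F) (lker (linfun (eval2 (0%R, x)))
                    :&: lker (linfun (eval2 (x, 0%R)))))%VS.

Lemma mem_ker_eval2 z (theta : map2) :
  (theta \in lker (linfun (eval2 z))) = (theta z == 0).
Proof. by rewrite memv_ker lfunE. Qed.

Lemma mem_Csp (theta : map2) :
  reflect (forall x, theta (0, x) = 0 /\ theta (x, 0) = 0) (theta \in Csp).
Proof.
apply: (iffP subv_bigcapP) => [h x | h x _].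
  move: (h x isT); rewrite -memvE memv_cap => /andP[h1 h2].
  by split; apply/eqP; [move: h1 | move: h2]; rewrite mem_ker_eval2.
have [h1 h2] := h x; rewrite -memvE memv_cap.
by apply/andP; split; rewrite mem_ker_eval2; apply/eqP.
Qed.

Definition hat (tau : map1) : map2 :=
  [ffun z => tau (z.1 + z.2) - tau z.1 - tau z.2].
Fact hat_is_linear : linear hat.
Proof.
move=> a u v; apply/ffunP=> z; rewrite !ffunE !scalerBr.
rewrite !opprD.
by rewrite [in LHS](addrACA (a *: u (z.1 + z.2)) (v (z.1 + z.2))) [LHS]addrACA.
Qed.
HB.instance Definition _ :=
  GRing.isLinear.Build 'F_p map1 map2 *:%R hat hat_is_linear.

(* B(F, A) *)
Definition Bsp : {vspace map2} :=
  (linfun hat @: lker (linfun (eval1 0%R)))%VS.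

Lemma mem_Bsp (theta : map2) :
  reflect (exists2 tau : map1, tau 0 = 0 & theta = hat tau) (theta \in Bsp).
Proof.
apply: (iffP memv_imgP) => [[tau] | [tau tau0 ->]].
  by rewrite memv_ker !lfunE /= => /eqP ? ->; exists tau.
by exists tau; rewrite ?memv_ker !lfunE //=; apply/eqP.
Qed.

Definition act alpha beta (theta : map2) : map2 :=
  [ffun z => beta (theta ((alpha^-1)%g z.1, (alpha^-1)%g z.2))].

(* linfun f agrees with f only when f is linear, hence Sop only has its intended
   meaning when beta is an automorphism (Sop_E). It is defined on all maps
   F * F -> 'F_p and stabilizes C(F, A) (Sop_Csp); KerS and Inv below are
   restricted to C(F, A). *)
Definition Sop alpha beta : 'End(map2) :=
  linfun (fun theta : map2 => theta - act alpha beta theta).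

Lemma Aut_linear beta : beta \in Aut [set: 'F_p] ->
  forall (a x y : 'F_p), beta (a * x + y) = a * beta x + beta y.
Proof.
move=> hb a x y; rewrite (Aut_D hb); congr (_ + _).
rewrite -[a]natr_Zp !mulr_natl; elim: (a : nat) => [|n IH].
  by rewrite !mulr0n (Aut_0 hb).
by rewrite !mulrS (Aut_D hb) IH.
Qed.

Lemma Sop_E alpha beta (theta : map2) : beta \in Aut [set: 'F_p] ->
  Sop alpha beta theta = theta - act alpha beta theta.
Proof.
move=> hb; pose f (th : map2) := th - act alpha beta th.
have f_lin : linear f.
  move=> a u v; apply/ffunP=> z; rewrite !ffunE.
  by rewrite (Aut_linear hb) scalerBr opprD addrACA.
pose m := GRing.isLinear.Build 'F_p map2 map2 *:%R f f_lin.
pose fL : {linear map2 -> map2} := HB.pack f m.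
exact: (lfunE fL).
Qed.

Definition KerS alpha beta : {vspace map2} :=
  (Csp :&: lker (Sop alpha beta))%VS.

Definition Inv alpha beta : {vspace map2} :=
  (Csp :&: Sop alpha beta @^-1: Bsp)%VS.

Lemma mem_Inv alpha beta (theta : map2) : beta \in Aut [set: 'F_p] ->
  (theta \in Inv alpha beta) =
  (theta \in Csp) && (theta - act alpha beta theta \in Bsp).
Proof. by move=> hb; rewrite memv_cap -memv_preim Sop_E. Qed.

(* Inv(alpha, beta) / B(F, A): the image of Inv in the quotient by B. *)
Definition InvQ alpha beta : {vspace quotv Bsp} :=
  (quotv_pi Bsp @: Inv alpha beta)%VS.

Lemma Bsp_sub_Csp : (Bsp <= Csp)%VS.
Proof.
apply/subvP=> _ /mem_Bsp[tau t0 ->]; apply/mem_Csp => x.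
by split; rewrite !ffunE /= ?add0r ?addr0 t0 subr0 subrr.
Qed.

Lemma Sop_Csp alpha beta : alpha \in Aut [set: F] ->
  beta \in Aut [set: 'F_p] -> (Sop alpha beta @: Csp <= Csp)%VS.
Proof.
move=> ha hb; apply/subvP=> _ /memv_imgP[th /mem_Csp h ->].
rewrite Sop_E //; apply/mem_Csp => x.
have [h1 h2] := h x; have [h3 h4] := h ((alpha^-1)%g x).
by rewrite !ffunE /= (Aut_0 (groupVr ha)) h1 h2 h3 h4 (Aut_0 hb) subr0.
Qed.

Lemma Bsp_sub_Inv alpha beta : alpha \in Aut [set: F] ->
  beta \in Aut [set: 'F_p] -> (Bsp <= Inv alpha beta)%VS.
Proof.
move=> ha hb; apply/subvP=> th thB; rewrite mem_Inv //.
rewrite (subvP Bsp_sub_Csp) //= memvB //.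
have [tau t0 ->] := mem_Bsp _ thB; apply/mem_Bsp.
exists [ffun x => beta (tau ((alpha^-1)%g x))].
  by rewrite ffunE (Aut_0 (groupVr ha)) t0 (Aut_0 hb).
apply/ffunP=> z; rewrite !ffunE /= (Aut_D (groupVr ha)).
by rewrite !(Aut_B hb).
Qed.

End Cochains.

(* Main.v *)
(* Let a = |alpha|, b = beta(1), and let g be the operator theta |-> (alpha,beta).theta,
   so that g^a = b^a. If theta - g theta = hat tau, applying 1 + g + ... + g^(a-1)
   gives (1 - b^a) theta = hat (norm of tau). If b^a <> 1, theta is in B and g has no
   invariants. If b^a = 1, then the norm of tau vanishes (hat is injective because
   Hom(Z_q, Z_p) = 0); as <alpha> acts freely on F \ {0}, the maps F \ {0} -> A form a
   free module over the cyclic group algebra, even when p divides a, so that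
   tau = sigma - g sigma and theta - hat sigma is g-invariant. The dimensions are then
   those of the g-invariants in C and in B, that is the numbers (q-1)^2/a and (q-1)/a of
   orbits of alpha on pairs of nonzero elements and on nonzero elements. *)
Require Import Defs.
From HB Require Import structures.
From mathcomp Require Import all_boot all_order all_algebra all_fingroup cyclic ring.
Import GRing.Theory.
Local Open Scope ring_scope.

(** * Equivariant functions on a union [D] of orbits of common length [a] *)

Section OrbitIndex.
Context {X : finType} {s : X -> X} {D : {pred X}} {a : nat}.
Hypotheses (s_inj : injective s) (D_closed : fclosed s D).
Hypothesis D_order : D \subset order_set s a.

Definition orbit_index (x : X) : nat := findex s (froot s x) x.

Lemma froot_step x : froot s (s x) = froot s x.
Proof.
apply/eqP; rewrite root_connect; last exact: fconnect_sym.
by rewrite -(same_fconnect1 s_inj) connect0.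
Qed.

Lemma fconnect_froot x : fconnect s (froot s x) x.
Proof. by rewrite fconnect_sym // connect_root. Qed.

Lemma mem_froot x : (froot s x \in D) = (x \in D).
Proof. exact: closed_connect (fconnect_froot x). Qed.

Lemma order_froot x : x \in D -> fingraph.order s (froot s x) = a.
Proof. by rewrite -mem_froot => /(subsetP D_order); rewrite inE => /eqP. Qed.

Lemma orbit_indexK x : iter (orbit_index x) s (froot s x) = x.
Proof. exact: iter_findex (fconnect_froot x). Qed.

Lemma orbit_index_stepK x : iter (orbit_index x).+1 s (froot s x) = s x.
Proof. by rewrite iterS orbit_indexK. Qed.

Lemma orbit_index_lt x : x \in D -> (orbit_index x < a)%N.
Proof. by move=> Dx; rewrite -(order_froot x) // findex_max // fconnect_froot. Qed.

Lemma orbit_index_step x : x \in D ->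
  orbit_index (s x) = if ((orbit_index x).+1 < a)%N then (orbit_index x).+1 else 0%N.
Proof.
move=> Dx; rewrite {1}/orbit_index froot_step -{1}orbit_index_stepK.
case: ltnP => [lt_ia | le_ai]; first by rewrite findex_iter // order_froot.
have -> : (orbit_index x).+1 = fingraph.order s (froot s x).
  by rewrite order_froot //; apply/eqP; rewrite eqn_leq orbit_index_lt.
by rewrite iter_order // findex0.
Qed.

Context {K : fieldType} {b : K}.
Hypothesis b_a : b ^+ a = 1.

(** The wrap-around of the index at [a] is absorbed by [b ^+ a = 1]. Thus the powers
    [b ^+ orbit_index x] solve the twisted invariance equation on [D]. *)
Lemma expr_orbit_index_step x : x \in D ->
  b ^+ orbit_index (s x) = b * b ^+ orbit_index x.
Proof.
move=> Dx; rewrite orbit_index_step // -exprS; case: ltnP => // le_ai.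
by have -> : (orbit_index x).+1 = a by apply/eqP; rewrite eqn_leq orbit_index_lt.
Qed.

(** A twisted invariant function is determined by its values at the roots of the orbits in [D], and
    these values are arbitrary. So the dimension is the number of orbits, each of size [a]. *)
Lemma dim_twisted_invariants (W : {vspace {ffun X -> K^o}}) :
    (forall f : {ffun X -> K^o}, reflect
       ((forall x, f (s x) = b * f x) /\ (forall x, x \notin D -> f x = 0))
       (f \in W)) ->
  (\dim W * a = #|D|)%N.
Proof.
move=> W_P; rewrite -(fcard_order_set s_inj D_order D_closed); congr (_ * _)%N.
pose I := {x | froots s x && (x \in D)}.
(* [insub] fails exactly when the root is outside [D]; the default 0 then makes the extension vanish
   off [D]. *)
pose ext (phi : {ffun I -> K^o}) : {ffun X -> K^o} :=
  [ffun x => b ^+ orbit_index x * oapp phi 0 (insub (froot s x))].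
have ext_lin : linear ext.
  move=> c u v; apply/ffunP=> x; rewrite !ffunE; case: insub => [i|] /=.
    by rewrite !ffunE mulrDr; congr (_ + _); rewrite /GRing.scale /= mulrCA.
  by rewrite !mulr0 addr0 scaler0.
pose extB := GRing.isLinear.Build K {ffun I -> K^o} {ffun X -> K^o} *:%R ext ext_lin.
pose extL : {linear {ffun I -> K^o} -> {ffun X -> K^o}} := HB.pack ext extB.
have extE phi : linfun extL phi = ext phi by rewrite lfunE.
have symS := fconnect_sym s_inj.
have -> : W = limg (linfun extL).
  apply/vspaceP=> f; apply/(W_P f)/memv_imgP => [[f_s f_D] | [phi _ ->]].
    exists [ffun i : I => f (val i)]; rewrite ?memvf // extE.
    apply/ffunP=> x; rewrite ffunE; case: insubP => [i _ i_x | ] /=.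
      rewrite ffunE i_x -[in LHS](orbit_indexK x); elim: (orbit_index x) => [|n IH] /=.
        by rewrite mul1r.
      by rewrite f_s IH exprS mulrA.
    by rewrite roots_root //= mem_froot mulr0 => /f_D.
  rewrite extE; split=> x; rewrite !ffunE.
    rewrite froot_step; case: insubP => [i /andP[_]|] /=; rewrite ?mulr0 //.
    by rewrite mem_froot => /expr_orbit_index_step -> _; rewrite mulrA.
  by move=> nDx; rewrite insubF ?mulr0 // mem_froot (negPf nDx) andbF.
rewrite limg_dim_eq; last first.
  apply/eqP; rewrite -subv0; apply/subvP=> phi.
  rewrite memv_cap memv_ker extE memv0 => /andP[_ /eqP ext0].
  apply/eqP/ffunP=> i; have := congr1 (fun f : {ffun X -> K^o} => f (val i)) ext0.
  rewrite !ffunE; have /andP[/eqP root_i _] := valP i.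
  by rewrite root_i valK /= /orbit_index root_i findex0 mul1r.
rewrite dimvf /dim /= muln1 card_sig.
by apply: eq_card => x; rewrite !inE.
Qed.

(* The H^1 vanishing: on an orbit {s^i r}, the partial sums
   sigma (s^i r) = sum_(j <= i) b^(i-j) tau (s^j r) solve the equation, and close
   up after a steps because the norm of tau vanishes. *)
Lemma twisted_coboundary (tau : X -> K) :
    (forall x, x \notin D -> tau x = 0) ->
    (forall x, \sum_(0 <= i < a) b ^+ (a.-1 - i) * tau (iter i s x) = 0) ->
  exists2 sigma : X -> K, (forall x, x \notin D -> sigma x = 0)
    & forall x, sigma (s x) - b * sigma x = tau (s x).
Proof.
move=> tau_D norm0.
pose part x n := \sum_(0 <= j < n.+1) b ^+ (n - j) * tau (iter j s x).
have partS x n : part x n.+1 = b * part x n + tau (iter n.+1 s x).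
  rewrite /part big_nat_recr //= subnn mul1r; congr (_ + _).
  by rewrite big_distrr /=; apply: eq_big_nat => j /andP[_ ?]; rewrite mulrA -exprS subSn.
exists (fun x => if x \in D then part (froot s x) (orbit_index x) else 0) => [x /negPf -> // | x].
have sxD : (s x \in D) = (x \in D) by rewrite -mem_froot froot_step mem_froot.
rewrite sxD; have [Dx | nDx] := boolP (x \in D); last first.
  by rewrite mulr0 subr0 tau_D ?sxD.
rewrite froot_step -[in RHS]orbit_index_stepK orbit_index_step //.
case: ltnP => [_ | le_ai]; first by rewrite partS addrC addKr.
have i_a : (orbit_index x).+1 = a by apply/eqP; rewrite eqn_leq orbit_index_lt.
(* At the last point of an orbit the partial sum is the full norm of [tau] at the root. *)
have -> : part (froot s x) (orbit_index x) = 0.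
  by rewrite -[RHS](norm0 (froot s x)) -i_a.
rewrite i_a -(order_froot x Dx) iter_order //.
by rewrite mulr0 subr0 /part big_nat1 subnn mul1r.
Qed.

End OrbitIndex.

Lemma dim_supported {K : fieldType} {X : finType} (D : {pred X})
    (W : {vspace {ffun X -> K^o}}) :
    (forall f : {ffun X -> K^o}, reflect (forall x, x \notin D -> f x = 0) (f \in W)) ->
  \dim W = #|D|.
Proof.
move=> W_P; rewrite -[LHS]muln1.
apply: (@dim_twisted_invariants X id D 1 _ _ _ K 1) => //.
- by move=> x y /eqP->.
- by apply/subsetP=> x _; rewrite inE order_id.
- move=> f; apply: (iffP (W_P f)) => [f_D | [] //].
  by split=> // x; rewrite mul1r.
Qed.

Lemma order_free_orbit {X : finType} {s : X -> X} {a : nat} x :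
    injective s -> (0 < a)%N -> iter a s x = x ->
    (forall n, iter n s x = x -> (a %| n)%N) ->
  fingraph.order s x = a.
Proof.
move=> s_inj a_gt0 iter_a a_dvd; apply/eqP; rewrite eqn_leq.
rewrite (dvdn_leq _ (a_dvd _ (iter_order s_inj x))) ?order_gt0 // andbT.
rewrite leqNgt; apply/negP=> /(@findex_iter _ _ x).
by rewrite iter_a findex0 => a0; rewrite -a0 in a_gt0.
Qed.

(** * Automorphisms of the two cyclic groups, and injectivity of [hat] *)

(** [gamma] is multiplication by [gamma 1], and a nonzero [x] is a unit. This gives the freeness of
    the action on nonzero elements. *)
Lemma Aut_Zq_fixed {q : nat} {gamma : {perm 'Z_q}} {x : 'Z_q} :
    prime q -> gamma \in Aut [set: 'Z_q] -> x != 0 -> gamma x = x ->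
  gamma = 1%g.
Proof.
move=> q_pr gammaA x_neq0 gamma_x; have q_gt1 := prime_gt1 q_pr.
have gammaE (y : 'Z_q) : gamma y = gamma 1 * y.
  rewrite -[y]natr_Zp mulr_natr; elim: (y : nat) => [|n IH].
    by rewrite !mulr0n (Aut_0 gammaA).
  by rewrite !mulrS (Aut_D gammaA) IH.
have Ux : x \is a GRing.unit.
  rewrite -[x]natr_Zp unitZpE // prime_coprime // gtnNdvd ?lt0n //.
  by rewrite -{2}(Zp_cast q_gt1) ltn_ord.
apply/permP=> y; rewrite perm1 gammaE.
suff -> : gamma 1 = 1 by rewrite mul1r.
by apply: (mulIr Ux); rewrite -gammaE mul1r.
Qed.

Lemma Aut_Fp_expg {p : nat} {beta : {perm 'F_p}} (n : nat) (x : 'F_p) :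
  beta \in Aut [set: 'F_p] -> (beta ^+ n)%g x = beta 1 ^+ n * x.
Proof.
move=> betaA; rewrite permX; elim: n => [|n /= ->]; first by rewrite mul1r.
rewrite -[_ * x in LHS]mulr1 -[_ * x * 1]addr0 (Aut_linear betaA) (Aut_0 betaA) addr0.
by rewrite mulrAC -exprSr.
Qed.

(** [beta] is multiplication by [beta 1]. This turns the divisibility of orders into a condition on
    a scalar. *)
Lemma order_dvdn_Aut_Fp {p : nat} {beta : {perm 'F_p}} (n : nat) :
  beta \in Aut [set: 'F_p] -> (#[beta]%g %| n)%N = (beta 1 ^+ n == 1).
Proof.
move=> betaA; rewrite order_dvdn; apply/eqP/eqP => [beta_n | b_n].
  by rewrite -[LHS]mulr1 -Aut_Fp_expg // beta_n perm1.
by apply/permP=> x; rewrite Aut_Fp_expg // b_n mul1r perm1.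
Qed.

(** A map killed by [hat] is a homomorphism, so q times [tau 1] equals [tau 0 = 0], while q is
    nonzero modulo p. *)
Lemma hat_inj {p q : nat} (tau : map1 'Z_q p) :
    prime p -> prime q -> p <> q -> tau 0 = 0 -> hat tau = 0 ->
  tau = 0.
Proof.
move=> p_pr q_pr neq_pq tau0 hat0.
have tauD x y : tau (x + y) = tau x + tau y.
  have /eqP := congr1 (fun f : map2 'Z_q p => f (x, y)) hat0.
  by rewrite !ffunE /= -addrA -opprD subr_eq0 => /eqP.
have tauM n : tau n%:R = tau 1 *+ n.
  by elim: n => [|n IH]; rewrite ?mulr0n // !mulrS tauD IH.
have tau1 : tau 1 = 0.
  have /eqP := tauM q; rewrite pchar_Zp ?prime_gt1 // tau0 eq_sym -mulr_natr mulf_eq0.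
  case/orP=> [/eqP // |]; rewrite -(dvdn_pcharf (pchar_Fp p_pr)) dvdn_prime2 //.
  by move/eqP.
by apply/ffunP=> x; rewrite -[x]natr_Zp tauM tau1 mul0rn ffunE.
Qed.

(** * The action of (alpha, beta) on cochains, and its invariants *)

Section CyclicCochains.
Context {p q : nat} {alpha : {perm 'Z_q}} {beta : {perm 'F_p}}.
Hypotheses (p_pr : prime p) (q_pr : prime q) (neq_pq : p <> q).
Hypotheses (alphaA : alpha \in Aut [set: 'Z_q]) (betaA : beta \in Aut [set: 'F_p]).

Local Notation a := (#[alpha]%g).
Local Notation b := (beta 1).
Local Notation B := (Bsp 'Z_q p).
Local Notation alpha2 := (fun z : 'Z_q * 'Z_q => (alpha z.1, alpha z.2)).

Lemma iter_alpha2 n (z : 'Z_q * 'Z_q) :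
  iter n alpha2 z = (iter n alpha z.1, iter n alpha z.2).
Proof. by elim: n => [|n /= ->] //; case: z. Qed.

Lemma alpha2_inj : injective alpha2.
Proof. by move=> [x y] [x' y'] /= [/perm_inj -> /perm_inj ->]. Qed.

Lemma iter_order_Aut (x : 'Z_q) : iter a alpha x = x.
Proof. by rewrite -permX expg_order perm1. Qed.

Lemma order_dvdn_fixed n (x : 'Z_q) : x != 0 -> iter n alpha x = x -> (a %| n)%N.
Proof.
rewrite -permX order_dvdn => x_neq0 /(Aut_Zq_fixed q_pr (groupX n alphaA) x_neq0)->.
exact: eqxx.
Qed.

Lemma alpha_eq0 (x : 'Z_q) : (alpha x == 0) = (x == 0).
Proof. by rewrite -{1}(Aut_0 alphaA) (inj_eq perm_inj). Qed.

Definition nz1 : {pred 'Z_q} := predC1 0.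
(** The maps vanishing off this set are exactly the elements of C(F, A). *)
Definition nz2 : {pred 'Z_q * 'Z_q} := [pred z | (z.1 != 0) && (z.2 != 0)].

Lemma nz1_closed : fclosed alpha nz1.
Proof. by move=> x y /eqP <-; rewrite !inE alpha_eq0. Qed.

Lemma nz2_closed : fclosed alpha2 nz2.
Proof. by move=> x y /eqP <-; rewrite !inE /= !alpha_eq0. Qed.

Lemma nz1_order : nz1 \subset order_set alpha a.
Proof.
apply/subsetP=> x x_neq0; rewrite inE; apply/eqP.
apply: (order_free_orbit _ (@perm_inj _ alpha)) => [||n].
- exact: order_gt0.
- exact: iter_order_Aut.
- exact: order_dvdn_fixed.
Qed.

Lemma nz2_order : nz2 \subset order_set alpha2 a.
Proof.
apply/subsetP=> z /andP[z1_neq0 _]; rewrite inE; apply/eqP.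
apply: (order_free_orbit _ alpha2_inj) => [||n].
- exact: order_gt0.
- by rewrite iter_alpha2 !iter_order_Aut; case: z {z1_neq0}.
- by rewrite iter_alpha2 => /(congr1 fst); apply: order_dvdn_fixed.
Qed.

Lemma card_nz1 : #|nz1| = q.-1.
Proof. by rewrite cardC1 card_ord Zp_cast ?prime_gt1. Qed.

Lemma card_nz2 : #|nz2| = (q.-1 * q.-1)%N.
Proof. by rewrite -card_nz1 -cardX; apply: eq_card => z; rewrite !inE. Qed.

Lemma beta_mul x : beta x = b * x.
Proof. by have := Aut_Fp_expg 1 x betaA; rewrite expg1 expr1. Qed.

Lemma mem_KerS (theta : map2 'Z_q p) : reflect
  ((forall z, theta (alpha2 z) = b * theta z) /\ (forall z, z \notin nz2 -> theta z = 0))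
  (theta \in KerS alpha beta).
Proof.
rewrite memv_cap memv_ker Sop_E // subr_eq0.
apply: (iffP andP) => [[/mem_Csp th0 /eqP th_inv] | [th_inv th_nz]].
  split=> [z | [x y]]; first by rewrite [in LHS]th_inv ffunE /= !permK beta_mul; case: z.
  by rewrite inE /= negb_and !negbK => /orP[]/eqP->; have [] := th0 x; have [] := th0 y.
split; first by apply/mem_Csp=> x; split; apply: th_nz; rewrite inE /= ?eqxx ?andbF.
apply/eqP/ffunP=> [[x y]]; rewrite ffunE /= beta_mul.
by have := th_inv ((alpha^-1)%g x, (alpha^-1)%g y); rewrite /= !permKV => ->.
Qed.

Lemma dim_KerS : b ^+ a = 1 -> (\dim (KerS alpha beta) * a = q.-1 * q.-1)%N.
Proof.
move=> b_a; rewrite -card_nz2.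
exact: (dim_twisted_invariants alpha2_inj nz2_closed nz2_order b_a _ mem_KerS).
Qed.

(** Going once around an orbit of [alpha2] multiplies an invariant by [b ^+ a] and returns to the
    same point. *)
Lemma KerS_eq0 : b ^+ a != 1 -> KerS alpha beta = 0%VS.
Proof.
move=> b_a; apply/eqP; rewrite -subv0; apply/subvP=> th /mem_KerS[th_inv _].
rewrite memv0; apply/eqP/ffunP=> z; rewrite ffunE.
have th_iter n : th (iter n alpha2 z) = b ^+ n * th z.
  by elim: n => [|n IH]; rewrite ?mul1r // iterS th_inv IH exprS mulrA.
have := th_iter a; rewrite iter_alpha2 !iter_order_Aut -surjective_pairing => /eqP.
by rewrite -[X in X == _]mul1r -subr_eq0 -mulrBl mulf_eq0 subr_eq0 eq_sym (negPf b_a) => /eqP.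
Qed.

(** * Dimensions of B and of its invariant part *)

Definition normalized : {vspace map1 'Z_q p} := lker (linfun (@eval1 'Z_q p 0)).

Lemma mem_normalized (tau : map1 'Z_q p) : (tau \in normalized) = (tau 0 == 0).
Proof. by rewrite memv_ker lfunE. Qed.

Lemma normalized_ker_hat : (normalized :&: lker (linfun (@hat 'Z_q p)) = 0)%VS.
Proof.
apply/eqP; rewrite -subv0; apply/subvP=> tau.
rewrite memv_cap mem_normalized memv_ker lfunE /= memv0 => /andP[/eqP tau0 /eqP hat0].
exact/eqP/(hat_inj tau p_pr q_pr neq_pq).
Qed.

Lemma dim_Bsp : \dim B = q.-1.
Proof.
rewrite /Bsp (limg_dim_eq normalized_ker_hat) -card_nz1; apply: dim_supported => tau.
rewrite mem_normalized; apply: (iffP eqP) => [tau0 x | tau_nz].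
  by rewrite inE negbK => /eqP->.
by apply: tau_nz; rewrite inE eqxx.
Qed.

(** Since [hat] is injective on normalized maps and compatible with the action, the invariants in B
    correspond to the invariant normalized maps, which are counted by orbits on [nz1]. *)
Lemma dim_KerS_cap_Bsp : b ^+ a = 1 -> (\dim (KerS alpha beta :&: B) * a = q.-1)%N.
Proof.
move=> b_a; pose W := (normalized :&: linfun (@hat 'Z_q p) @^-1: KerS alpha beta)%VS.
have -> : (KerS alpha beta :&: B = linfun (@hat 'Z_q p) @: W)%VS.
  apply/vspaceP=> th; apply/idP/memv_imgP => [|[tau]].
    rewrite memv_cap => /andP[thK /memv_imgP[tau tau0 th_tau]].
    by exists tau; rewrite // memv_cap tau0 -memv_preim -th_tau.
  rewrite [tau \in W]memv_cap -memv_preim => /andP[tau0 htau] ->.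
  by rewrite memv_cap htau memv_img.
rewrite limg_dim_eq; last first.
  apply/eqP; rewrite -subv0 -normalized_ker_hat; apply: capvS => //; exact: capvSl.
rewrite -card_nz1.
apply: (dim_twisted_invariants (@perm_inj _ alpha) nz1_closed nz1_order b_a) => tau.
rewrite memv_cap mem_normalized -memv_preim lfunE /=.
apply: (iffP andP) => [[/eqP tau0 /mem_KerS[tau_inv _]] | [tau_inv tau_nz]].
  split=> [x | x]; last by rewrite inE negbK => /eqP->.
  (* [rho] is the defect of equivariance of [tau]; invariance of [hat tau] gives [hat rho = 0]. *)
  pose rho : map1 'Z_q p := [ffun x => tau (alpha x) - b * tau x].
  suff rho0 : rho = 0.
    have /eqP := congr1 (fun f : map1 'Z_q p => f x) rho0.
    by rewrite !ffunE subr_eq0 => /eqP.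
  apply: (hat_inj _ p_pr q_pr neq_pq).
    by rewrite ffunE (Aut_0 alphaA) tau0 mulr0 subr0.
  apply/ffunP=> z; have := tau_inv z; rewrite !ffunE /= -(Aut_D alphaA) => /eqP.
  rewrite -subr_eq0 => /eqP <-.
  by ring.
have tau0 : tau 0 = 0 by apply: tau_nz; rewrite inE eqxx.
rewrite tau0; split=> //; apply/mem_KerS; split=> [z | z].
  by rewrite !ffunE /= -(Aut_D alphaA) !tau_inv !mulrBr.
rewrite inE negb_and !negbK !ffunE.
by case/orP=> /eqP->; rewrite ?add0r ?addr0 tau0 subr0 subrr.
Qed.

(* Applying the norm of the cyclic group generated by (alpha, beta) to the equation
   (1 - (alpha, beta)) theta = hat tau makes its left-hand side telescope. *)
Lemma hat_norm (theta : map2 'Z_q p) (tau : map1 'Z_q p) (z : 'Z_q * 'Z_q) :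
    theta - Defs.act alpha beta theta = hat tau ->
  let rho : map1 'Z_q p :=
    [ffun x => \sum_(0 <= i < a) b ^+ (a.-1 - i) * tau (iter i alpha x)] in
  hat rho (alpha2 z) = (1 - b ^+ a) * theta z.
Proof.
move=> th_tau rho.
have step (y : 'Z_q * 'Z_q) : theta (alpha2 y) - b * theta y = hat tau (alpha2 y).
  by case: y => x y; rewrite -th_tau !ffunE /= !permK (beta_mul (theta _)).
have iterD n x y : iter n alpha (x + y) = iter n alpha x + iter n alpha y.
  by rewrite -!permX (Aut_D (groupX n alphaA)).
have iter_z n : iter n alpha2 (alpha2 z) = alpha2 (iter n alpha2 z).
  by rewrite -iterSr.
transitivity (\sum_(0 <= i < a) b ^+ (a.-1 - i) * hat tau (iter i alpha2 (alpha2 z))).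
  rewrite !ffunE /= -!sumrB; apply: eq_bigr => i _.
  by rewrite iter_alpha2 ffunE /= iterD !mulrBr.
(* The end values are [theta z] at [i = a] and [b ^+ a * theta z] at [i = 0]. *)
rewrite (@telescope_sumr_eq _ 0 a (fun i => b ^+ (a - i) * theta (iter i alpha2 z))) //.
  rewrite subnn subn0 /= iter_alpha2 !iter_order_Aut -surjective_pairing.
  by rewrite mulrBl.
move=> i /andP[_ lt_ia]; rewrite iter_z -step iterS mulrBr mulrA -exprSr.
by rewrite subnS -subn1 subnAC subn1 prednK ?subn_gt0.
Qed.

(** * The decomposition of Inv *)

Lemma Inv_eq : Inv alpha beta = (KerS alpha beta + B)%VS.
Proof.
apply/eqP; rewrite eqEsubv; apply/andP; split; last first.
  rewrite subv_add Bsp_sub_Inv // andbT capvS //.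
  apply/subvP=> th; rewrite -memv_preim memv_ker => /eqP->; exact: mem0v.
apply/subvP=> th; rewrite mem_Inv // => /andP[thC /mem_Bsp[tau tau0 th_tau]].
pose rho : map1 'Z_q p :=
  [ffun x => \sum_(0 <= i < a) b ^+ (a.-1 - i) * tau (iter i alpha x)].
have hat_rho z : hat rho (alpha2 z) = (1 - b ^+ a) * th z := hat_norm th tau z th_tau.
have rho0 : rho 0 = 0.
  rewrite ffunE big1 // => i _.
  by rewrite -permX (Aut_0 (groupX i alphaA)) tau0 mulr0.
have [b_a | b_a] := eqVneq (b ^+ a) 1; last first.
  apply: (subvP (addvSr _ _)); apply/mem_Bsp.
  have c_neq0 : 1 - b ^+ a != 0 by rewrite subr_eq0 eq_sym.
  (* The argument [alpha x] matches [hat_rho], which evaluates [hat rho] at [alpha2 z]. *)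
  exists [ffun x => (1 - b ^+ a)^-1 * rho (alpha x)].
    by rewrite ffunE (Aut_0 alphaA) rho0 mulr0.
  apply/ffunP=> z; apply: (mulfI c_neq0); rewrite -hat_rho !ffunE /=.
  by rewrite !mulrBr !mulVKf // (Aut_D alphaA).
(* Now [hat rho] vanishes at every [alpha2 z], hence everywhere, as [alpha] is bijective. *)
have rho_eq0 : rho = 0.
  apply: (hat_inj _ p_pr q_pr neq_pq) => //; apply/ffunP=> [[x y]].
  have := hat_rho ((alpha^-1)%g x, (alpha^-1)%g y).
  by rewrite /= !permKV b_a subrr mul0r => ->; rewrite ffunE.
have [||sg sg_nz sgE] := twisted_coboundary (b := b) (@perm_inj _ alpha) nz1_closed nz1_order tau.
- by move=> x; rewrite inE negbK => /eqP->.
- by move=> x; have := congr1 (fun f : map1 'Z_q p => f x) rho_eq0; rewrite !ffunE.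
pose sigma : map1 'Z_q p := [ffun x => sg x].
have sigma0 : sigma 0 = 0 by rewrite ffunE sg_nz // inE eqxx.
have hatB : hat sigma \in B by apply/mem_Bsp; exists sigma.
rewrite -[th](subrK (hat sigma)); apply: memv_add => //.
rewrite memv_cap; apply/andP; split.
  by rewrite memvB // (subvP (Bsp_sub_Csp _ _)).
rewrite memv_ker linearB /= !Sop_E //.
rewrite th_tau subr_eq0; apply/eqP/ffunP=> z; rewrite !ffunE /= beta_mul.
rewrite -(Aut_D (groupVr alphaA)).
(* This is [tau] = sigma - g sigma; applying [hat] shows that [th - hat sigma] is invariant. *)
have tauE x : tau x = sg x - b * sg ((alpha^-1)%g x).
  by rewrite -{1}[x](permKV alpha) -sgE permKV.
by rewrite !tauE; ring.
Qed.

End CyclicCochains.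

(** * Dimension count for Inv and Inv/B *)

Theorem theorem6p5 (p q : nat) (p_prime : prime p) (q_prime : prime q)
    (neq_pq : p <> q)
    (alpha : {perm 'Z_q}) (alpha_aut : alpha \in Aut [set: 'Z_q])
    (beta : {perm 'F_p}) (beta_aut : beta \in Aut [set: 'F_p]) :
  [/\ Inv alpha beta = (KerS alpha beta + Bsp 'Z_q p)%VS,
      (\dim (Inv alpha beta))%:R =
        (if (#[beta]%g %| #[alpha]%g)%N
         then (q%:R - 1) + (q%:R - 1) * (q%:R - 2%:R) / #[alpha]%g%:R
         else q%:R - 1) :> rat
    & (\dim (InvQ alpha beta))%:R =
        (if (#[beta]%g %| #[alpha]%g)%N
         then (q%:R - 1) * (q%:R - 2%:R) / #[alpha]%g%:R
         else 0) :> rat].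
Proof.
have dimB := dim_Bsp p_prime q_prime neq_pq.
have InvE := Inv_eq p_prime q_prime neq_pq alpha_aut beta_aut.
have qE : q%:R = q.-1%:R + 1 :> rat by rewrite natr1 prednK ?prime_gt0.
(* Rank-nullity for the projection restricted to Inv, whose kernel is B. *)
have dimInv : (\dim (Inv alpha beta) = \dim (InvQ alpha beta) + q.-1)%N.
  rewrite -(limg_ker_dim (quotv_pi (Bsp 'Z_q p))) lker_quotv_pi addnC.
  by rewrite (capv_idPr (Bsp_sub_Inv alpha_aut beta_aut)) dimB.
suff dimQ : (\dim (InvQ alpha beta))%:R =
        (if (#[beta]%g %| #[alpha]%g)%N
         then (q%:R - 1) * (q%:R - 2%:R) / #[alpha]%g%:R
         else 0) :> rat.
  split=> //; rewrite dimInv natrD dimQ qE addrK.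
  by case: ifP => _; rewrite ?add0r // addrC.
rewrite (order_dvdn_Aut_Fp _ beta_aut); case: eqP => [b_a | /eqP b_a]; last first.
  move: dimInv; rewrite InvE (KerS_eq0 beta_aut b_a) add0v dimB.
  by move/eqP; rewrite -[X in X == _]add0n eqn_add2r => /eqP <-.
have dimK := dim_KerS q_prime alpha_aut beta_aut b_a.
have dimKB := dim_KerS_cap_Bsp p_prime q_prime neq_pq alpha_aut beta_aut b_a.
have a_neq0 : #[alpha]%g%:R != 0 :> rat by rewrite Num.Theory.pnatr_eq0 -lt0n order_gt0.
(* Numerical form of the isomorphism between (Ker S + B)/B and the quotient of Ker S by its
   intersection with B. *)
have dimQK : (\dim (InvQ alpha beta) + \dim (KerS alpha beta :&: Bsp 'Z_q p)
              = \dim (KerS alpha beta))%N.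
  apply/eqP; rewrite -(eqn_add2r q.-1) addnAC -dimInv InvE -dimB.
  by rewrite dimv_sum_cap.
(* After multiplication by the order of [alpha], the claim is (q-1)^2 - (q-1) = (q-1)(q-2). *)
apply: (mulIf a_neq0); rewrite divfK // -natrM.
have := congr1 (fun n => n%:R : rat) (congr1 (muln^~ #[alpha]%g) dimQK).
rewrite mulnDl dimK dimKB !natrD => /(canRL (addrK _)) ->.
by rewrite natrM qE addrK -[2%:R]/(1 + 1) opprD addrA addrK mulrBr mulr1.
Qed.
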